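(* Let $\Omega\subset\mathbb{R}^n$, $n\ge2$, be a bounded domain, $T>0$ and $\sigma\in\mathbb{R}$ a constant. Let $\zeta:\Omega_T\cup P_T\to\mathbb{R}$ be lower semi-continuous in $\Omega_T\cup P_T$ and satisfy, in the viscosity sense, $$\Delta_\infty\zeta+\sigma|D\zeta|^4\le3\zeta_t\quad\text{in }\Omega_T .$$ Let $m=\inf_{P_T}\zeta>-\infty$. If there is a point $(y,s)\in\Omega_T$ such that $\zeta(y,s)=m$, then $$\zeta(y,t)=m\quad\text{for all }0<t\le s .$$
   Context: Notation: $\Omega_T=\Omega\times(0,T)$; $P_T=(\Omega\times\{0\})\cup(\partial\Omega\times[0,T))$. $\Delta_\infty\zeta=\sum_{i,j}\zeta_{x_i}\zeta_{x_j}\zeta_{x_ix_j}$ and $D\zeta$ is the gradient in $x$. $\mathcal S(n)$ is the set of symmetric $n\times n$ real matrices. Semi-jets: for $(y,s)\in\Omega_T$, $(a,p,X)\in\mathbb{R}\times\mathbb{R}^n\times\mathcal S(n)$ belongs to $\mathcal P^+_{\Omega_T}u(y,s)$ if $u(x,t)\le u(y,s)+a(t-s)+\langle p,x-y\rangle+\tfrac12\langle X(x-y),x-y\rangle+o(|t-s|+|x-y|^2)$ as $(x,t)\to(y,s)$ in $\Omega_T$; $\mathcal P^-_{\Omega_T}u=-\mathcal P^+_{\Omega_T}(-u)$. $\Delta_\infty\zeta+\sigma|D\zeta|^4\le3\zeta_t$ in $\Omega_T$ means: $\zeta$ is lower semi-continuous in $\Omega_T$ and $\langle Yq,q\rangle+\sigma|q|^4-3b\le0$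 for all $(y,s)\in\Omega_T$ and $(b,q,Y)\in\mathcal P^-_{\Omega_T}\zeta(y,s)$. *)

(* Defs.v *)
From HB Require Import structures.
From mathcomp Require Export all_boot all_order all_algebra.
From mathcomp Require Export all_classical all_reals all_analysis.
Export Order.TTheory GRing.Theory Num.Theory.
Export numFieldNormedType.Exports.

Set Implicit Arguments.
Unset Strict Implicit.
Unset Printing Implicit Defensive.

Local Open Scope classical_set_scope.
Local Open Scope ring_scope.

(* Points of R^n are row vectors. The norm `|x| of MathComp-Analysis on them is
   the sup norm (it gives the usual topology and bounded sets); the Euclidean
   norm that enters the equation is defined here. *)
Definition dot (R : realType) (n : nat) (u v : 'rV[R]_n) : R :=
  \sum_(i < n) u 0 i * v 0 i.

Definition enorm (R : realType) (n : nat) (u : 'rV[R]_n) : R :=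
  Num.sqrt (dot u u).

(* <X u, u>; in row-vector form X u is u *m X^T. *)
Definition quad (R : realType) (n : nat) (X : 'M[R]_n) (u : 'rV[R]_n) : R :=
  dot (u *m X^T) u.

Definition bounded_domain (R : realType) (n : nat) (Omega : set 'rV[R]_n) :=
  [/\ open Omega, connected Omega, Omega !=set0 & bounded_set Omega].

Definition boundary (X : topologicalType) (A : set X) : set X :=
  closure A `\` interior A.

Definition cylinder (R : realType) (n : nat) (Omega : set 'rV[R]_n) (T : R) :
    set ('rV[R]_n * R) :=
  Omega `*` [set` `]0, T[].

Definition parabolic_boundary (R : realType) (n : nat)
    (Omega : set 'rV[R]_n) (T : R) : set ('rV[R]_n * R) :=
  (Omega `*` [set 0]) `|` (boundary Omega `*` [set` `[0, T[]).

(* A function on a subset A of space-time is a total function of which only the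
   values on A matter; its semicontinuity is taken in the topology of A. *)
Definition lower_semicontinuous_in (R : realType) (X : topologicalType)
    (A : set X) (f : X -> R) :=
  lower_semicontinuous ((fun z => (f z)%:E) : subspace A -> \bar R).

(* For Q = Omega_T; the little-o in the one-sided inequality is unfolded. *)
Definition superjet (R : realType) (n : nat) (Q : set ('rV[R]_n * R))
    (u : 'rV[R]_n * R -> R) (z0 : 'rV[R]_n * R) :
    set (R * 'rV[R]_n * 'M[R]_n) :=
  [set j | let: (a, p, X) := j in let: (y, s) := z0 in
    X^T = X /\
    forall e : R, 0 < e ->
      \forall z \near within Q (nbhs (y, s)), let: (x, t) := z in
        u (x, t) <= u (y, s) + a * (t - s) + dot p (x - y)
                    + 2^-1 * quad X (x - y)
                    + e * (`|t - s| + enorm (x - y) ^+ 2)].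

Definition subjet (R : realType) (n : nat) (Q : set ('rV[R]_n * R))
    (u : 'rV[R]_n * R -> R) (z0 : 'rV[R]_n * R) :
    set (R * 'rV[R]_n * 'M[R]_n) :=
  [set - j | j in superjet Q (\- u) z0].

(* Delta_oo zeta + sigma |D zeta|^4 <= 3 zeta_t in Q, in the viscosity sense. *)
Definition viscosity_supersolution (R : realType) (n : nat)
    (Q : set ('rV[R]_n * R)) (sigma : R) (zeta : 'rV[R]_n * R -> R) :=
  lower_semicontinuous_in Q zeta /\
  forall (z : 'rV[R]_n * R) (b : R) (q : 'rV[R]_n) (Y : 'M[R]_n),
    Q z -> subjet Q zeta z (b, q, Y) ->
    quad Y q + sigma * enorm q ^+ 4 - 3 * b <= 0.

(* Main.v *)
Require Import Defs.
From mathcomp Require Import ring lra.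
Local Open Scope classical_set_scope.
Local Open Scope ring_scope.

(** The operator Delta_oo z + sigma |Dz|^4 is cubic and quartic in the size of
z, whereas z_t is linear. A function of small amplitude therefore is a strict
classical subsolution as soon as it decreases in time at a rate comparable with
its amplitude, whatever the sign of sigma. This makes positivity at a point
persist there for all later times, with no need for a propagation in space.

In detail, the minimum principle first gives zeta >= m on the closed cylinder.
If zeta(y,t) > m at some 0 < t < s, lower semicontinuity gives c, r > 0 with
zeta(.,t) >= m + c on a ball of radius r around y. The paraboloid

    m + h (r^2 - |x - y|^2) - k (u - t),   k = h r^2 / (2 (s - t)),

is at most m on the lateral boundary of the ball times [t, T), at most m + c at
time t if h r^2 <= c, and for h small it is a strict subsolution: its time
derivative is -k, of order h, and the other terms are of order h^3 and h^4.
Hence zeta stays above it, and at (y,s) its value is m + h r^2 / 2 > m. So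
zeta(y,s) = m forces zeta(y,t) = m for all earlier t.

[barrier_below] is the comparison of a supersolution with such a paraboloid; it
is a direct application of the definition, because the paraboloid is smooth.
[minimum_principle] is the case h = 0, k -> 0 of it, and [positivity_persists]
is the case described above. *)

(** * Minima of lower semicontinuous functions on compact sets *)

(** The sets of z in K with f z <= f c, for c in K, are nonempty and nested, so
they generate a filter, which clusters at some p in K. If f p were not the
minimum, then f c < f p for some c in K, and semicontinuity would keep f above
f c near p, away from the sublevel set of c. *)
Lemma lsc_attains_min {R : realType} {X : topologicalType} (K : set X)
    (f : X -> R) :
  compact K -> K !=set0 ->
  (forall p a, K p -> a < f p -> \forall z \near within K (nbhs p), a < f z) ->
  exists2 p, K p & forall z, K z -> f p <= f z.
Proof.
move=> cK [w Kw] lscf; apply: contrapT => nomin.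
have lower p : K p -> exists2 z, K z & f z < f p.
  move=> Kp; apply: contrapT => np; apply: nomin; exists p => // z Kz.
  by rewrite leNgt; apply/negP => zp; apply: np; exists z.
pose B (c : X) := [set z | K z /\ f z <= f c].
have FB : Filter (filter_from K B).
  apply: filter_from_filter; first by exists w.
  move=> i j Ki Kj; have [ij|/ltW ji] := leP (f i) (f j).
    by exists i => // z [Kz zi]; split; split => //; exact: le_trans ij.
  by exists j => // z [Kz zj]; split; split => //; exact: le_trans ji.
have PB : ProperFilter (filter_from K B).
  by apply: filter_from_proper => c Kc; exists c; split.
have [|p [Kp clp]] := cK _ PB; first by exists w => // z [].
have [c Kc cp] := lower p Kp.
have [z [[Kz zc] /(_ Kz)]] := clp _ _ (ex_intro2 _ _ c Kc (fun z h => h))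
  (lscf p _ Kp cp).
by rewrite ltNge zc.
Qed.

Lemma lsc_sub_continuous {R : realType} {X : topologicalType} (A K : set X)
    (f psi : X -> R) (p : X) (a : R) :
  lower_semicontinuous_in A f -> K `<=` A -> K p ->
  {for p, continuous psi} -> a < f p - psi p ->
  \forall z \near within K (nbhs p), a < f z - psi z.
Proof.
move=> lscf KA Kp cpsi ap.
pose e := (f p - psi p - a) / 2.
have e0 : 0 < e by rewrite /e; lra.
have ltf : ((f p - e)%:E < (f p)%:E)%E by rewrite lte_fin; lra.
have [V nV fV] := lscf p _ ltf.
have {}nV : within A (nbhs p) V by rewrite nbhs_subspace_in//; exact: KA.
have /cvgrPdist_lt/(_ e e0) psie := cpsi.
change (\forall z \near p, K z -> a < f z - psi z); near=> z => Kz.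
have Vz : V z by (suff: A z -> V z by apply; exact: KA); near: z.
have := fV z Vz; rewrite lte_fin.
have : `|psi p - psi z| < e by near: z.
by rewrite ltr_norml /e; lra.
Unshelve. all: by end_near.
Qed.

(** * The Euclidean product and the sup norm *)

Section Dot.
Context {R : realType} {n : nat}.
Implicit Types (u v x y : 'rV[R]_n) (c : R).

Lemma dot_ge0 u : 0 <= dot u u.
Proof. by apply: sumr_ge0 => i _; rewrite -expr2 sqr_ge0. Qed.

Lemma enorm_sq u : enorm u ^+ 2 = dot u u.
Proof. by rewrite sqr_sqrtr // dot_ge0. Qed.

Lemma enorm_quartic u : enorm u ^+ 4 = dot u u ^+ 2.
Proof. by rewrite -enorm_sq -exprM. Qed.

Lemma dotZl c u v : dot (c *: u) v = c * dot u v.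
Proof. by rewrite /dot mulr_sumr; apply: eq_bigr => i _; rewrite mxE mulrA. Qed.

Lemma dotZr c u v : dot u (c *: v) = c * dot u v.
Proof.
by rewrite /dot mulr_sumr; apply: eq_bigr => i _; rewrite mxE mulrCA.
Qed.

Lemma quad_scalar c u : quad (c%:M) u = c * dot u u.
Proof. by rewrite /quad tr_scalar_mx mul_mx_scalar dotZl. Qed.

Lemma dotDD u v : dot (u + v) (u + v) = dot u u + 2 * dot u v + dot v v.
Proof.
rewrite /dot mulr_sumr -!big_split /=; apply: eq_bigr => i _.
by rewrite !mxE; ring.
Qed.

Lemma coord_le_norm u i : `|u 0 i| <= `|u|.
Proof.
rewrite [`|u|]mx_normrE.
exact: (le_bigmax _ (fun ij : 'I_1 * 'I_n => `|u ij.1 ij.2|) (0, i)).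
Qed.

(** This bound and the next one compare the norm of the topology, which gives the balls,
with the Euclidean norm of the barrier. *)
Lemma dot_le_norm u : dot u u <= n%:R * `|u| ^+ 2.
Proof.
rewrite /dot (_ : n%:R * _ = \sum_(i < n) `|u| ^+ 2); last first.
  by rewrite sumr_const card_ord mulr_natl.
apply: ler_sum => i _; rewrite -expr2 -real_normK ?num_real//.
by rewrite lerXn2r ?nnegrE ?normr_ge0 ?coord_le_norm.
Qed.

Lemma norm_le_dot u : `|u| ^+ 2 <= dot u u.
Proof.
have [->|u0] := eqVneq `|u| 0; first by rewrite expr0n dot_ge0.
have [[i0 i] /=] := mx_norm_neq0 u0; rewrite ord1 => ui.
have -> : `|u| = `|u 0 i| := ui.
rewrite real_normK ?num_real//.
rewrite /dot (bigD1 i)//= expr2 lerDl.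
by apply: sumr_ge0 => j _; rewrite -expr2 sqr_ge0.
Qed.

Lemma continuous_coordB y i : continuous (fun x : 'rV[R]_n => (x - y) 0 i).
Proof.
rewrite (_ : (fun x : 'rV[R]_n => _) = (fun x : 'rV[R]_n => x 0 i - y 0 i)).
  move=> x; apply: continuousB.
    exact: coord_continuous.
  exact: cst_continuous.
by apply/funext => x; rewrite !mxE.
Qed.

Lemma continuous_dot_sub y : continuous (fun x => dot (x - y) (x - y)).
Proof.
apply: continuous_big => [|i _ x]; first exact: add_continuous.
by apply: (@continuousM R _ (fun x : 'rV[R]_n => (x - y) 0 i));
  exact: continuous_coordB.
Qed.

End Dot.

(** * Comparison with paraboloids *)

(** The squared positive part exceeds its tangent line by at most the square of
the increment; this controls the time expansion of the barrier below. *)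
Lemma sq_max0_le {R : realDomainType} (u v : R) :
  Num.max 0 u ^+ 2 <=
  Num.max 0 v ^+ 2 + 2 * Num.max 0 v * (u - v) + (u - v) ^+ 2.
Proof.
have := sqr_ge0 u; have := sqr_ge0 (u - v).
by have [u0|/ltW u0] := leP 0 u; have [v0|/ltW v0] := leP 0 v; nra.
Qed.

(** The last term vanishes up to time s, so the barrier is the paraboloid where
the comparison is wanted; for M large it brings the barrier below any lower
bound of the supersolution at a later time, which keeps the contact point away
from the final time. *)
Definition barrier {R : realType} {n : nat} (y : 'rV[R]_n) (a h k M t0 s : R)
    (z : 'rV[R]_n * R) : R :=
  a - h * dot (z.1 - y) (z.1 - y) - k * (z.2 - t0)
    - M * Num.max 0 (z.2 - s) ^+ 2.

Section Barrier.
Context {R : realType} {n : nat}.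
Implicit Types (x y : 'rV[R]_n) (Q : set ('rV[R]_n * R)).

Lemma continuous_barrier y (a h k M t0 s : R) :
  continuous (barrier y a h k M t0 s).
Proof.
move=> z; rewrite /continuous_at /barrier.
have cz1 : (fun w : 'rV[R]_n * R => w.1) @ z --> z.1 by exact: cvg_fst.
have cz2 : (fun w : 'rV[R]_n * R => w.2) @ z --> z.2 by exact: cvg_snd.
have cd : (fun w : 'rV[R]_n * R => dot (w.1 - y) (w.1 - y)) @ z -->
    dot (z.1 - y) (z.1 - y).
  by apply: (cvg_comp _ _ cz1 (continuous_dot_sub _ _)).
have cm : (fun w : 'rV[R]_n * R => Num.max 0 (w.2 - s)) @ z -->
    Num.max 0 (z.2 - s).
  apply: (@continuous_max R _ (cst 0) (fun w : 'rV[R]_n * R => w.2 - s)).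
    exact: cvg_cst.
  by apply: cvgB => //; exact: cvg_cst.
apply: cvgB; last by apply: cvgM; [exact: cvg_cst|exact: cvgM].
apply: cvgB; last first.
  apply: cvgM; [exact: cvg_cst|apply: cvgB => //; exact: cvg_cst].
by apply: cvgB; [exact: cvg_cst|apply: cvgM => //; exact: cvg_cst].
Qed.

(** The barrier is quadratic in x, so its expansion in x is exact; in time the
error is at most M |t - t1|^2, which is o(|t - t1|). *)
Lemma barrier_superjet {Q} {zeta : 'rV[R]_n * R -> R} {y} {a h k M t0 s : R}
    {x1 : 'rV[R]_n} {t1 : R} (B := barrier y a h k M t0 s) :
  0 <= M ->
  (\forall z \near within Q (nbhs (x1, t1)),
     zeta (x1, t1) - B (x1, t1) <= zeta z - B z) ->
  superjet Q (\- zeta) (x1, t1)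
    (k + 2 * M * Num.max 0 (t1 - s), (2 * h) *: (x1 - y), (2 * h)%:M).
Proof.
move=> M0 touch; split; first exact: tr_scalar_mx.
move=> e e0.
have M1 : 0 < e / (M + 1) by apply: divr_gt0 => //; lra.
have close : \forall z \near within Q (nbhs (x1, t1)),
    `|t1 - z.2| < e / (M + 1).
  apply: cvg_within.
  have cz2 : (fun z : 'rV[R]_n * R => z.2) @ (x1, t1) --> t1 by exact: cvg_snd.
  by have /cvgrPdist_lt/(_ _ M1) := cz2.
move: touch close; apply: filterS2 => -[x t] /= touch.
rewrite distrC => close.
have split_x : x - y = (x1 - y) + (x - x1) by rewrite [RHS]addrC subrKA.
rewrite quad_scalar dotZl enorm_sq.
move: touch; rewrite /B /barrier /= {}split_x (dotDD (x1 - y) (x - x1)).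
set d := dot (x1 - y) (x1 - y); set dv := dot (x1 - y) (x - x1).
set v := dot (x - x1) (x - x1).
have v0 : 0 <= v := dot_ge0 _.
have := sq_max0_le (t - s) (t1 - s).
rewrite (_ : t - s - (t1 - s) = t - t1); last by ring.
set p := Num.max 0 (t - s); set p1 := Num.max 0 (t1 - s) => tangent.
have Mp : M * p ^+ 2 <= M * (p1 ^+ 2 + 2 * p1 * (t - t1) + (t - t1) ^+ 2).
  by rewrite ler_wpM2l.
have quadratic : M * (t - t1) ^+ 2 <= e * `|t - t1|.
  rewrite -real_normK ?num_real// expr2 mulrA ler_wpM2r//.
  move: close; rewrite ltr_pdivlMr; last by lra.
  have := normr_ge0 (t - t1); nra.
have : 0 <= e * v by rewrite mulr_ge0// ltW.
lra.
Qed.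

(** If the supersolution went below the paraboloid at time s, then its difference
with the barrier would have a negative minimum over K x [t0, T'] for some T'
between s and T. The boundary inequalities exclude t0 and the complement of K0,
the cutoff excludes T', and at a point of K0 x (t0, T') the barrier touches
from below. There the equation contradicts the hypothesis that the paraboloid is
a strict subsolution, since the time derivative of the cutoff has the
favourable sign. *)
Lemma barrier_below {Omega : set 'rV[R]_n} {T sigma : R}
    {zeta : 'rV[R]_n * R -> R} {A : set ('rV[R]_n * R)}
    {K K0 : set 'rV[R]_n} {y : 'rV[R]_n} {a h k t0 s : R} :
  lower_semicontinuous_in A zeta ->
  viscosity_supersolution (cylinder Omega T) sigma zeta ->
  compact K -> open K0 -> K0 `<=` K -> K0 `<=` Omega ->
  K `*` [set` `[t0, T[] `<=` A ->
  0 <= t0 -> t0 <= s -> s < T -> 0 <= h -> 0 <= k ->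
  (forall x, K0 x -> 0 < 3 * k - 8 * h ^+ 3 * dot (x - y) (x - y)
                         + 16 * sigma * h ^+ 4 * dot (x - y) (x - y) ^+ 2) ->
  (forall x, K x -> a - h * dot (x - y) (x - y) <= zeta (x, t0)) ->
  (forall x t, K x -> ~ K0 x -> t0 <= t -> t < T ->
     a - h * dot (x - y) (x - y) - k * (t - t0) <= zeta (x, t)) ->
  forall x, K x -> a - h * dot (x - y) (x - y) - k * (s - t0) <= zeta (x, s).
Proof.
move=> lscz [_ visc] cK oK0 K0K K0O KA t00 t0s sT h0 k0 strict bottom side x Kx.
pose T' := (s + T) / 2; pose C := K `*` [set` `[t0, T']].
have sT' : s < T' by rewrite /T'; lra.
have T'T : T' < T by rewrite /T'; lra.
have cC : compact C by apply: compact_setX => //; exact: segment_compact.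
have CA : C `<=` A.
  move=> [u t] [/= Ku]; rewrite in_itv /= => /andP[t0t tT']; apply: KA.
  by split => //=; rewrite in_itv /= t0t (le_lt_trans tT').
have Cxs : C (x, s) by split => //=; rewrite in_itv /= t0s ltW.
have minC (psi : 'rV[R]_n * R -> R) : continuous psi ->
    exists2 p, C p & forall z, C z -> zeta p - psi p <= zeta z - psi z.
  move=> cpsi; apply: (lsc_attains_min C (fun z => zeta z - psi z)) => //.
    by exists (x, s).
  move=> p b Cp bp; exact: (lsc_sub_continuous _ _ _ _ _ _ lscz CA Cp (cpsi p) bp).
have [p0 Cp0 minL] := minC (fun=> 0) (fun z => @cst_continuous _ _ 0 z).
pose L := zeta p0.
have zL z : C z -> L <= zeta z by move/minL; rewrite !subr0.
(* This M makes the barrier at time T' at most a - |a - L| <= L. *)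
pose M := `|a - L| / (T' - s) ^+ 2.
have M0 : 0 <= M by rewrite /M divr_ge0// sqr_ge0.
have MT' : M * (T' - s) ^+ 2 = `|a - L|.
  by rewrite /M divfK// expf_neq0// subr_eq0 gt_eqF.
pose B := barrier y a h k M t0 s.
have [[x1 t1] [/= Kx1]] := minC B (@continuous_barrier _ _ _ _ _ _ _).
rewrite in_itv /= => /andP[t0t1 t1T'] minB.
rewrite leNgt; apply/negP => zB.
have : zeta (x1, t1) - B (x1, t1) < 0.
  apply: le_lt_trans (minB _ Cxs) _.
  by rewrite /B /barrier /= subrr maxxx expr0n mulr0 subr0 subr_lt0.
rewrite {1}/B /barrier /= => neg.
have d0 := dot_ge0 (x1 - y).
have hd0 : 0 <= h * dot (x1 - y) (x1 - y) by rewrite mulr_ge0.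
have cutoff0 : 0 <= M * Num.max 0 (t1 - s) ^+ 2 by rewrite mulr_ge0// sqr_ge0.
have kt0 : 0 <= k * (t1 - t0) by rewrite mulr_ge0// subr_ge0.
have K0x1 : K0 x1.
  by apply: contrapT => nK0; have := side x1 t1 Kx1 nK0 t0t1; lra.
have t0t1' : t0 < t1.
  rewrite lt_neqAle t0t1 andbT; apply/eqP => e0.
  by have := bottom _ Kx1; rewrite e0; lra.
have t1T'' : t1 < T'.
  rewrite lt_neqAle t1T' andbT; apply/eqP => e0.
  have Cp : C (x1, t1) by split => //=; rewrite in_itv /= t0t1 t1T'.
  have mx : Num.max 0 (T' - s) = T' - s by rewrite max_r// subr_ge0 ltW.
  move: neg (zL _ Cp) kt0 (ler_norm (a - L)).
  by rewrite e0 mx MT'; lra.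
have touch : \forall z \near within (cylinder Omega T) (nbhs (x1, t1)),
    zeta (x1, t1) - B (x1, t1) <= zeta z - B z.
  apply: cvg_within.
  exists (K0, [set` `]t0, T'[]) => /=.
    split; first exact: open_nbhs_nbhs.
    by apply: open_nbhs_nbhs; split; [exact: interval_open|rewrite /= in_itv /= t0t1'].
  move=> [u t] /= [K0u]; rewrite in_itv /= => /andP[tl tr]; apply: minB.
  by split; [exact: K0K|rewrite /= in_itv /= !ltW].
have jet := barrier_superjet M0 touch.
have Qp : cylinder Omega T (x1, t1).
  by split; [exact: K0O|rewrite /= in_itv /=; apply/andP; split; lra].
have := visc (x1, t1) _ _ _ Qp (ex_intro2 _ _ _ jet erefl).
rewrite /= -scaleNr -(raddfN (@scalar_mx R n)) quad_scalar enorm_quartic.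
rewrite !(dotZl, dotZr).
have Mmax : 0 <= M * Num.max 0 (t1 - s).
  by rewrite mulr_ge0// le_max lexx.
have := strict _ K0x1; set d := dot _ _.
rewrite [X in _ < X -> _](_ : _ = 3 * k
  + - (2 * h) * (- (2 * h) * (- (2 * h) * d))
  + sigma * (- (2 * h) * (- (2 * h) * d)) ^+ 2); last by ring.
lra.
Qed.

End Barrier.

(** * Minimum principle and persistence of positivity *)

Section Comparison.
Context {R : realType} {n : nat}.
Implicit Types (Omega : set 'rV[R]_n) (zeta : 'rV[R]_n * R -> R).

Lemma slab_subset Omega (T : R) :
  closure Omega `*` [set` `[0, T[] `<=`
  cylinder Omega T `|` parabolic_boundary Omega T.
Proof.
move=> [x t] [/= Kx]; rewrite in_itv /= => /andP[t0 tT].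
have [Ox|nOx] := pselect (Omega x); last first.
  right; right; split => /=; last by rewrite in_itv /= t0.
  by split => //; apply: contra_not nOx; exact: interior_subset.
move: t0; rewrite le_eqVlt => /predU1P[<-|t0]; first by right; left.
by left; split => //=; rewrite in_itv /= t0.
Qed.

(** The barriers are the functions m - k t, for every k > 0. *)
Lemma minimum_principle Omega (T sigma m : R) zeta :
  open Omega -> bounded_set Omega ->
  lower_semicontinuous_in
    (cylinder Omega T `|` parabolic_boundary Omega T) zeta ->
  viscosity_supersolution (cylinder Omega T) sigma zeta ->
  (forall z, parabolic_boundary Omega T z -> m <= zeta z) ->
  forall x t, closure Omega x -> 0 <= t -> t < T -> m <= zeta (x, t).
Proof.
move=> oO bO lscz superz mP.
have cK : compact (closure Omega).
  apply: bounded_closed_compact; last exact: closed_closure.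
  have [M [Mr MO]] := bO.
  pose r := M + 1.
  have Or : closure Omega `<=` closed_ball_ (@Num.Def.normr R _) 0 r.
    have /closure_id -> := @closed_closed_ball_ R 'rV[R]_n 0 r.
    apply: closure_subset => x Ox; rewrite /closed_ball_ /= sub0r normrN.
    by apply: MO => //; rewrite ltrDl.
  exists r; split => [|r' rr' x /Or]; first exact: num_real.
  by rewrite /closed_ball_ /= sub0r normrN => /le_trans; apply; exact: ltW.
move=> x t Kx t0 tT; apply/ler_addgt0Pr => e e0.
have t1 : 0 < t + 1 by lra.
pose k := e / (t + 1).
have k0 : 0 < k by rewrite divr_gt0.
have ke : k * (t + 1) = e by rewrite divfK// gt_eqF.
have : m - 0 * dot (x - x) (x - x) - k * (t - 0) <= zeta (x, t).
  apply: (barrier_below lscz superz cK oO (@subset_closure _ _) (fun _ => id)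
    (@slab_subset _ _) (lexx 0) t0 tT (lexx 0) (ltW k0)) => //.
  - by move=> u _; rewrite !expr0n /=; lra.
  - move=> u Ku; rewrite mul0r subr0; apply: mP.
    have [Ou|nOu] := pselect (Omega u); first by left.
    right; split => /=; last by rewrite in_itv /= lexx (le_lt_trans t0).
    by split => //; apply: contra_not nOu; exact: interior_subset.
  - move=> u v Ku nOu v0 vT; rewrite mul0r !subr0.
    apply: (@le_trans _ _ m); first by rewrite gerBl mulr_ge0// ltW.
    apply: mP; right; split => /=; last by rewrite in_itv /= v0.
    by split => //; apply: contra_not nOu; exact: interior_subset.
rewrite mul0r !subr0; nra.
Qed.

(** A paraboloid of small amplitude h r^2 over a ball of radius r around y, which
loses only half of its height between the times t and s, is a strict
subsolution: see the introduction. *)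
Lemma positivity_persists Omega (T sigma m : R) zeta (y : 'rV[R]_n) (t s : R) :
  open Omega ->
  lower_semicontinuous_in
    (cylinder Omega T `|` parabolic_boundary Omega T) zeta ->
  viscosity_supersolution (cylinder Omega T) sigma zeta ->
  (forall x u, Omega x -> 0 < u -> u < T -> m <= zeta (x, u)) ->
  Omega y -> 0 < t -> t < s -> s < T -> m < zeta (y, t) -> m < zeta (y, s).
Proof.
move=> oO lscz superz mz Oy t0 ts sT mzt.
pose D := cylinder Omega T `|` parabolic_boundary Omega T.
pose c := (zeta (y, t) - m) / 2.
have c0 : 0 < c by rewrite /c; lra.
have [r r0 [ballO ballz]] : exists2 r : R, 0 < r &
    (forall x, `|y - x| <= r -> Omega x) /\
    (forall x, `|y - x| <= r -> m + c <= zeta (x, t)).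
  have ltz : ((m + c)%:E < (zeta (y, t))%:E)%E by rewrite lte_fin /c; lra.
  have [V nV zV] := lscz (y, t) _ ltz.
  have tT : t < T := lt_trans ts sT.
  have QD x : Omega x -> D (x, t).
    by move=> Ox; left; split => //=; rewrite in_itv /= t0.
  have {}nV : within D (nbhs (y, t)) V.
    by rewrite nbhs_subspace_in//; exact: QD.
  have /nbhs_ballP[e e0 eO] : nbhs y (Omega `&` [set x | D (x, t) -> V (x, t)]).
    apply: filterI; first exact: open_nbhs_nbhs.
    have [[U W] /= [nU nW] UW] := nV.
    by apply: filterS nU => x Ux; apply: UW; split => //=; exact: nbhs_singleton.
  exists (e / 2); first exact: divr_gt0.
  have inB x : `|y - x| <= e / 2 -> ball y e x.
    by rewrite -ball_normE /= => /le_lt_trans; apply; move: e0 => /=; lra.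
  split => x /inB /eO [Ox Vx] //.
  by have := zV _ (Vx (QD _ Ox)); rewrite lte_fin => /ltW.
pose N : R := n%:R.
have N0 : 0 <= N by exact: ler0n.
(* Since d <= N r^2 on the ball and h <= 1, the cubic and quartic terms of the
   operator sum to at most h r^2 * (h S) in absolute value. They are dominated
   by 3k = 3 h r^2 / (2 (s - t)) as soon as h S (s - t) <= 1. *)
pose S := 8 * N + 16 * `|sigma| * N ^+ 2 * r ^+ 2.
have S0 : 0 <= S.
  apply: addr_ge0; first by rewrite mulr_ge0.
  by do 3!(rewrite mulr_ge0 ?sqr_ge0//).
(* The three terms of w = 1/h give h <= 1, h r^2 <= c and h S (s - t) <= 1. *)
pose w := 1 + r ^+ 2 / c + (s - t) * S.
have st0 : 0 < s - t by lra.
have rc0 : 0 <= r ^+ 2 / c by rewrite divr_ge0 ?sqr_ge0// ltW.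
have sS0 : 0 <= (s - t) * S by rewrite mulr_ge0// ltW.
have w0 : 0 < w by rewrite /w; lra.
pose h := w^-1.
have h0 : 0 < h by rewrite invr_gt0.
have hw : h + h * (r ^+ 2 / c) + h * ((s - t) * S) = 1.
  by rewrite -[X in X + _ + _]mulr1 -!mulrDr mulVf// gt_eqF.
have h1 : h <= 1 by rewrite invf_le1// /w; lra.
have hrc : h * r ^+ 2 <= c.
  have : h * (r ^+ 2 / c) <= 1.
    move: hw.
    have : 0 <= h * ((s - t) * S) by rewrite mulr_ge0// ltW.
    lra.
  by rewrite mulrA ler_pdivrMr// mul1r.
have hS : (s - t) * (h * S) <= 1.
  rewrite mulrCA; move: hw.
  have : 0 <= h * (r ^+ 2 / c) by rewrite mulr_ge0// ltW.
  lra.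
pose P := h * r ^+ 2.
have P0 : 0 < P by rewrite mulr_gt0// exprn_gt0.
pose k := P / (2 * (s - t)).
have kst : k * (s - t) = P / 2 by rewrite /k; field; lra.
have k0 : 0 < k by rewrite divr_gt0// mulr_gt0.
pose K := [set x : 'rV[R]_n | `|y - x| <= r].
have KE : K = closed_ball y r by rewrite closed_ballE.
have KO : K `<=` Omega := ballO.
have cK : compact K.
  apply: bounded_closed_compact; last by rewrite KE; exact: closed_ball_closed.
  exists (`|y| + r); split => [|M' yM x /= yx]; first exact: num_real.
  rewrite -[x](subKr y); apply: le_trans (ler_normB _ _) _.
  by apply: le_trans (ltW yM); rewrite lerD2l.
have dK x : K x -> dot (x - y) (x - y) <= N * r ^+ 2.
  move=> Kx; apply: le_trans (dot_le_norm _) _.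
  by rewrite ler_wpM2l// lerXn2r ?nnegrE ?(ltW r0)// distrC.
have KD : K `*` [set` `[t, T[] `<=` D.
  move=> [x v] /= [/= Kx]; rewrite in_itv /= => /andP[tv vT]; left.
  by split; [exact: KO|rewrite /= in_itv /= vT (lt_le_trans t0)].
have ballK : ball y r `<=` K by move=> x; rewrite -ball_normE => /ltW.
have : m + P - h * dot (y - y) (y - y) - k * (s - t) <= zeta (y, s).
  apply: (barrier_below lscz superz cK (ball_open y r) ballK
    (subset_trans ballK KO) KD (ltW t0) (ltW ts) sT (ltW h0) (ltW k0)).
  - move=> x; rewrite -ball_normE => /ltW Kx.
    have d0 := dot_ge0 (x - y); have := dK _ Kx.
    set d := dot _ _ => dN.
    have PhS : P * (h * S) <= 2 * k.
      rewrite -(ler_pM2l st0) mulrCA (le_trans (ler_wpM2l (ltW P0) hS))//.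
      lra.
    have h2 : h ^+ 2 <= h by rewrite expr2 ger_pMr.
    have h3 : h ^+ 3 <= h by rewrite exprS ger_pMr// expr_le1// ltW.
    have cubic : 8 * h ^+ 3 * d <= P * (h * (8 * N)).
      have -> : P * (h * (8 * N)) = 8 * h * (h * (N * r ^+ 2)).
        by rewrite /P; ring.
      have -> : 8 * h ^+ 3 * d = 8 * h * (h ^+ 2 * d) by ring.
      rewrite ler_pM2l; last by rewrite mulr_gt0.
      by apply: ler_pM => //; exact: sqr_ge0.
    have quartic : 16 * `|sigma| * h ^+ 4 * d ^+ 2 <=
        P * (h * (16 * `|sigma| * N ^+ 2 * r ^+ 2)).
      have -> : P * (h * (16 * `|sigma| * N ^+ 2 * r ^+ 2)) =
          16 * `|sigma| * h * (h * (N * r ^+ 2) ^+ 2) by rewrite /P; ring.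
      have -> : 16 * `|sigma| * h ^+ 4 * d ^+ 2 =
          16 * `|sigma| * h * (h ^+ 3 * d ^+ 2) by ring.
      apply: ler_wpM2l; first by rewrite !mulr_ge0// ltW.
      apply: ler_pM => //; first by rewrite exprn_ge0// ltW.
        exact: sqr_ge0.
      by rewrite lerXn2r// nnegrE (le_trans d0).
    have hd0 : 0 <= h ^+ 4 * d ^+ 2.
      by rewrite mulr_ge0 ?sqr_ge0// exprn_ge0// ltW.
    have := ler_wpM2r hd0 (ler_norm (- sigma)); rewrite normrN.
    move: PhS cubic quartic; rewrite /S !mulrDr; lra.
  - move=> x Kx; apply: le_trans (ballz _ Kx).
    have : 0 <= h * dot (x - y) (x - y) by rewrite mulr_ge0 ?dot_ge0// ltW.
    by rewrite /P; lra.
  - move=> x v Kx nK0 tv vT.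
    apply: (@le_trans _ _ m); last first.
      by apply: mz => //; [exact: KO|lra].
    have rd : r ^+ 2 <= dot (x - y) (x - y).
      apply: le_trans (norm_le_dot _); rewrite lerXn2r ?nnegrE ?(ltW r0)// distrC.
      by rewrite leNgt; apply/negP => xr; apply: nK0; rewrite -ball_normE.
    have : P <= h * dot (x - y) (x - y) by rewrite ler_pM2l.
    have : 0 <= k * (v - t) by rewrite mulr_ge0 ?subr_ge0// ltW.
    lra.
  - by rewrite /K /= subrr normr0 ltW.
have -> : dot (y - y) (y - y) = 0.
  by rewrite subrr /dot big1// => i _; rewrite mxE mul0r.
by rewrite mulr0 kst; lra.
Qed.
End Comparison.

Theorem lemma3p8 (R : realType) (n : nat) (hn : (2 <= n)%N)
  (Omega : set 'rV[R]_n) (hOmega : bounded_domain Omega)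
  (T : R) (hT : 0 < T) (sigma : R)
  (zeta : 'rV[R]_n * R -> R)
  (hlsc : lower_semicontinuous_in
            (cylinder Omega T `|` parabolic_boundary Omega T) zeta)
  (hvisc : viscosity_supersolution (cylinder Omega T) sigma zeta)
  (m : R)
  (hm : ereal_inf [set (zeta z)%:E | z in parabolic_boundary Omega T] = m%:E)
  (y : 'rV[R]_n) (s : R) (hys : cylinder Omega T (y, s))
  (hmin : zeta (y, s) = m) :
  forall t : R, 0 < t -> t <= s -> zeta (y, t) = m.
Proof.
move=> t t0; rewrite le_eqVlt => /predU1P[->//|ts].
have [oO _ _ bO] := hOmega.
have [/= Oy] := hys; rewrite in_itv /= => /andP[s0 sT].
have mP z : parabolic_boundary Omega T z -> m <= zeta z.
  by move=> Pz; rewrite -lee_fin -hm; apply: ereal_inf_lbound; exists z.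
have mz x u : Omega x -> 0 < u -> u < T -> m <= zeta (x, u).
  move=> Ox /ltW u0 uT.
  exact: (minimum_principle _ _ _ _ _ oO bO hlsc hvisc mP)
    (subset_closure Ox) u0 uT.
apply/eqP; rewrite eq_le mz ?(lt_trans ts)// andbT leNgt; apply/negP => mzt.
have := positivity_persists _ _ _ _ _ _ _ _ oO hlsc hvisc mz Oy t0 ts sT mzt.
by rewrite hmin ltxx.
Qed.
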